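(* $\mathrm{MCFT}=\mathrm{DMT}_{\mathrm{fc}}(\mathrm{RT})$ and $\mathrm{MRT}=\mathrm{DT}_{\mathrm{fc}}(\mathrm{RT})$; that is, the tree languages generated by MCFTGs (resp. MRTGs) are exactly the images of regular tree languages under total deterministic finite-copying macro tree transducers (simple in the parameters) (resp. total deterministic finite-copying top-down tree transducers).
   Context: **Sequences and trees.** $\mathbb N_0$ is the set of nonnegative integers, $[n]=\{1,\dots,n\}$. $A^*$ (resp. $A^+$) is the set of finite (resp. nonempty finite) sequences over $A$; a sequence of length 1 is identified with its element; juxtaposition is concatenation; $\mathrm{occ}(w)$ is the set of elements occurring in the sequence $w$; $w$ is repetition-free if no element occurs twice in it. A ranked alphabet is a set $\Sigma$ with a rank map $\mathrm{rk}\colon\Sigma\to\mathbb N_0$ (applied elementwise to sequences); $\Sigma^{(k)}$ is the set of symbols of rank $k$. $T_\Sigma$ is the set of trees over $\Sigma$: the smallest set of strings over $\Sigma$ containing $\sigma t_1\cdots t_k$ (also written $\sigma(t_1,\dots,t_k)$) for all $\sigma\in\Sigma^{(k)}$ and $t_i\in T_\Sigma$. A forest is a finite sequence of trees. $X=\{x_1,x_2,\dots\}$ is a set of variables (of rank 0, disjoint from other alphabets), $X_k=\{x_1,\dots,x_k\}$. A pattern of rank $k$ over $\Sigma$ is a tree over $\Sigma\cup X_k$ in which each of $x_1,\dots,x_k$ occurs exactly once; $P_\Sigma(X_k)$ is the set of these and $P_\Sigma(X)=\bigcup_k P_\Sigma(X_k)$. For a forest $t$, $\mathrm{occ}_\Omega(t)$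 is the set of symbols of $\Omega$ occurring in $t$; $t$ is uniquely $\Omega$-labeled if each symbol of $\Omega$ occurs at most once in $t$. **Substitution.** For a repetition-free sequence of symbols $\sigma=(\sigma_1,\dots,\sigma_n)$ and patterns $u=(u_1,\dots,u_n)$ with $\mathrm{rk}(u)=\mathrm{rk}(\sigma)$, $t[\sigma\gets u]$ is obtained from $t$ by replacing, recursively, each subtree $\sigma_i(s_1,\dots,s_k)$ by $u_i$ in which $x_j$ is replaced by the transformed $s_j$ (componentwise on forests). For $\mathcal L=\{B_1,\dots,B_k\}$ with $B_1\cdots B_k$ repetition-free and forests $f(B_i)$ with $\mathrm{rk}(f(B_i))=\mathrm{rk}(B_i)$, $t[B\gets f(B)\mid B\in\mathcal L]$ means $t[B_1\cdots B_k\gets f(B_1)\cdots f(B_k)]$. **MCFTG.** A multiple context-free tree grammar (MCFTG) is $G=(N,\mathcal N,\Sigma,S,R)$ where $N$ is a finite ranked alphabet of nonterminals; $\mathcal N\subseteq N^+$ is a finite set of repetition-free sequences (big nonterminals) with $\mathrm{occ}(A)\ne\mathrm{occ}(A')$ for distinct $A,A'\in\mathcal N$; $\Sigma$ is a finite ranked alphabet of terminals, disjoint from $N$, containing a symbol of rank at least 1; $S\in\mathcal N\cap N^{(0)}$ is the initial nonterminal; $R$ is a finite set of rules $A\to(u,\mathcal L)$ with $A\in\mathcal N$, $u\in P_{N\cup\Sigma}(X)^+$ a uniquely $N$-labeled forest with $\mathrm{rk}(u)=\mathrm{rk}(A)$, and $\mathcal L\subseteq\mathcal N$ (the links) such that the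 sets $\mathrm{occ}(B)$, $B\in\mathcal L$, are pairwise disjoint with union $\mathrm{occ}_N(u)$. The sets $L(G,A)$, $A\in\mathcal N$, are simultaneously the smallest sets of forests such that for every rule $A\to(u,\mathcal L)$ and all $f(B)\in L(G,B)$ ($B\in\mathcal L$), $u[B\gets f(B)\mid B\in\mathcal L]\in L(G,A)$. $L(G)=L(G,S)\subseteq T_\Sigma$. An MRTG is an MCFTG all of whose nonterminals have rank 0. $\mathrm{MCFT}$ (resp. $\mathrm{MRT}$) is the class of tree languages generated by MCFTGs (resp. MRTGs). $\mathrm{RT}$ is the class of regular tree languages (over finite ranked alphabets). **Macro tree transducers.** A $\mathrm{DMT}_{\mathrm{sp}}$-transducer is $M=(Q,\Omega,\Sigma,q_0,R)$ with a finite ranked alphabet $Q$ of states, finite ranked alphabets $\Omega,\Sigma$ of input and output symbols with $Q\cap\Sigma=\emptyset$, an initial state $q_0\in Q^{(0)}$, and, for every $q\in Q^{(m)}$ and $\omega\in\Omega^{(k)}$, exactly one rule $\langle q,\omega(y_1,\dots,y_k)\rangle(x_1,\dots,x_m)\to\zeta$ with $\zeta=\mathrm{rhs}_M(q,\omega)\in P_{(Q\times Y_k)\cup\Sigma}(X_m)$, where $Y_k=\{y_1,\dots,y_k\}$ and $\langle q',y_i\rangle$ has the rank of $q'$. For $s=\omega(s_1,\dots,s_k)\in T_\Omega$, $M_q(s)=\mathrm{rhs}_M(q,\omega)[\langle q',y_i\rangle\gets M_{q'}(s_i)\mid q'\in Q,1\le i\le k]\in P_\Sigma(X_{\mathrm{rk}(q)})$.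 $M$ realizes the total function $s\mapsto M(s)=M_{q_0}(s)$ from $T_\Omega$ to $T_\Sigma$. It is a $\mathrm{DT}$-transducer (top-down tree transducer) if all states have rank 0. For $\omega\in\Omega^{(k)}$, $i\in[k]$ and $q_1,\dots,q_n\in Q$, $\mathrm{sts}_{\omega,i}(q_1,\dots,q_n)\in Q^*$ is the sequence of states obtained from the string $\mathrm{rhs}_M(q_1,\omega)\cdots\mathrm{rhs}_M(q_n,\omega)$ by replacing each $\langle q',y_i\rangle$ by $q'$ and erasing all other symbols. The set $\mathrm{sts}(M)$ of state sequences is the smallest subset of $Q^*$ containing $q_0$ and closed under all $\mathrm{sts}_{\omega,i}$. $M$ is finite-copying if $\mathrm{sts}(M)$ is finite; $\mathrm{DMT}_{\mathrm{fc}}$ (resp. $\mathrm{DT}_{\mathrm{fc}}$) is the class of transductions realized by finite-copying $\mathrm{DMT}_{\mathrm{sp}}$-transducers (resp. $\mathrm{DT}$-transducers). For a class $\mathcal X$ of transductions, $\mathcal X(\mathrm{RT})=\{M(L): M\in\mathcal X, L\in\mathrm{RT}\}$. *)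

(* Defs.v *)
From mathcomp Require Import all_boot finmap.
From mathcomp Require Import classical_sets cardinality.

Set Implicit Arguments.
Unset Strict Implicit.
Unset Printing Implicit Defensive.

Local Open Scope fmap_scope.
Local Open Scope classical_set_scope.

(* Trees over S and the variables X: [Var j] is the variable x_{j+1}.         *)
Inductive term (S : Type) : Type :=
| Var of nat
| Op of S & seq (term S).
Arguments Var {S} j.
Arguments Op {S} s ts.

Fixpoint vars (S : Type) (t : term S) : seq nat :=
  match t with
  | Var j => [:: j]
  | Op _ ts => flatten (map (@vars S) ts)
  end.

(* The non-variable symbols in the order in which they occur in the string    *)
(* sigma t_1 ... t_k, i.e., in preorder.                                      *)
Fixpoint labels (S : Type) (t : term S) : seq S :=
  match t with
  | Var _ => [::]
  | Op s ts => s :: flatten (map (@labels S) ts)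
  end.

(* A ranked alphabet inside S is a partial map: rk s = Some k if s belongs to *)
(* the alphabet and has rank k, and rk s = None if s is not in the alphabet.  *)
Fixpoint ranked (S : Type) (rk : S -> option nat) (t : term S) : bool :=
  match t with
  | Var _ => true
  | Op s ts => (rk s == Some (size ts)) && all (ranked rk) ts
  end.

Definition pattern (S : Type) (rk : S -> option nat) (k : nat) (t : term S) :
    bool :=
  ranked rk t && perm_eq (vars t) (iota 0 k).

(* Input and output symbols are drawn from one fixed infinite supply, so that *)
(* tree languages over different alphabets can be compared as sets.           *)
Definition symbol : Type := nat.

Definition alphabet : Type := {fmap nat -> nat}.

Definition rank_in (Sigma : alphabet) (a : symbol) : option nat := Sigma.[? a].

Definition language : Type := set (term symbol).

Definition trees (Sigma : alphabet) : language :=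
  [set t | pattern (rank_in Sigma) 0 t].

Fixpoint plug (S : Type) (ss : seq (term S)) (u : term S) : term S :=
  match u with
  | Var j => nth (Var j) ss j
  | Op s ts => Op s (map (plug ss) ts)
  end.

(* Second-order substitution t[n <- h n | n in N], where all symbols of N are *)
(* replaced, so that the result has symbols in S only.                        *)
Fixpoint subst (N S : Type) (h : N -> term S) (t : term (N + S)) : term S :=
  match t with
  | Var j => Var j
  | Op (inl n) ts => plug (map (subst h) ts) (h n)
  | Op (inr s) ts => Op s (map (subst h) ts)
  end.

(* t[B <- f B | B in L], for a list L = B_1, ..., B_k with B_1 ... B_k        *)
(* repetition-free. The value of the [nth] default is irrelevant when every   *)
(* symbol of N in t occurs in B_1 ... B_k and f B is as long as B.            *)
Definition link_subst (N : eqType) (S : Type) (L : seq (seq N))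
    (f : seq N -> seq (term S)) (t : term (N + S)) : term S :=
  subst (fun n => nth (Var 0) (flatten (map f L)) (index n (flatten L))) t.

Definition left_labels (N S : Type) (u : seq (term (N + S))) : seq N :=
  pmap (fun s => if s is inl n then Some n else None)
       (flatten (map (@labels _) u)).

Definition sum_rank (N S : Type) (rkN : N -> option nat) (rkS : S -> option nat)
    (s : N + S) : option nat :=
  match s with inl n => rkN n | inr a => rkS a end.

(* The nonterminals are disjoint from the terminals through the sum type. The *)
(* finite set of rules is a family rule_lhs r -> (rule_rhs r, rule_links r)   *)
(* indexed by a finite type, and the finite sets [bignt] and [rule_links r]   *)
(* are given by lists. For a list of repetition-free nonempty sequences,      *)
(* uniqueness of the concatenation says that the list has no duplicates and   *)
(* that its members have pairwise disjoint sets of symbols.                   *)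
Record mcftg : Type := Mcftg {
  nonterm : finType;
  nrank : nonterm -> nat;
  bignt : seq (seq nonterm);
  terminals : alphabet;
  start : nonterm;
  rule : finType;
  rule_lhs : rule -> seq nonterm;
  rule_rhs : rule -> seq (term (nonterm + symbol));
  rule_links : rule -> seq (seq nonterm);

  bignt_nonempty : [::] \notin bignt;
  bignt_uniq : {in bignt, forall A, uniq A};
  bignt_occ : {in bignt &, forall A B, A =i B -> A = B};
  terminals_rank : exists a k, rank_in terminals a = Some k.+1;
  start_bignt : [:: start] \in bignt;
  start_rank : nrank start = 0;
  rule_lhs_bignt : forall r, rule_lhs r \in bignt;
  rule_rhs_pattern : forall r,
    all2 (fun n u =>
            pattern (sum_rank (fun m => Some (nrank m)) (rank_in terminals))
                    (nrank n) u)
         (rule_lhs r) (rule_rhs r);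
  rule_rhs_uniq : forall r, uniq (left_labels (rule_rhs r));
  rule_links_bignt : forall r, {subset rule_links r <= bignt};
  rule_links_disjoint : forall r, uniq (flatten (rule_links r));
  rule_links_cover : forall r,
    flatten (rule_links r) =i left_labels (rule_rhs r)
}.

Inductive generates (G : mcftg) :
    seq (nonterm G) -> seq (term symbol) -> Prop :=
| Generates (r : rule G) (f : seq (nonterm G) -> seq (term symbol)) :
    (forall B, B \in rule_links r -> generates B (f B)) ->
    generates (rule_lhs r) (map (link_subst (rule_links r) f) (rule_rhs r)).

Definition mcftg_language (G : mcftg) : language :=
  [set t | generates [:: start G] [:: t]].

Definition is_mrtg (G : mcftg) : Prop := forall n : nonterm G, nrank n = 0.

Definition MCFT : set language :=
  [set L | exists G : mcftg, mcftg_language G = L].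

Definition MRT : set language :=
  [set L | exists G : mcftg, is_mrtg G /\ mcftg_language G = L].

(* Nondeterministic bottom-up finite tree automata; trans w ps p stands for   *)
(* the transition w(p_1, ..., p_k) -> p.                                      *)
Record nfta : Type := Nfta {
  astate : finType;
  aalphabet : alphabet;
  trans : symbol -> seq astate -> astate -> bool;
  final : pred astate
}.

Inductive run (A : nfta) : term symbol -> astate A -> Prop :=
| Run (w : symbol) (ts : seq (term symbol)) (ps : seq (astate A))
      (p : astate A) :
    rank_in (aalphabet A) w = Some (size ts) ->
    size ps = size ts ->
    (forall i, i < size ts -> run (nth (Var 0) ts i) (nth p ps i)) ->
    trans w ps p ->
    run (Op w ts) p.

Definition nfta_language (A : nfta) : language :=
  [set t | exists2 p : astate A, final p & run t p].

Definition RT : set language :=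
  [set L | exists A : nfta, nfta_language A = L].

(* The alphabet Q x Y_k; the pair (q, i) is <q, y_{i+1}>.                     *)
Definition call_rank (Q : Type) (rkQ : Q -> nat) (k : nat) (c : Q * nat) :
    option nat :=
  if c.2 < k then Some (rkQ c.1) else None.

(* States are disjoint from output symbols through the sum type. The value of *)
(* [rhs q w] matters only for w in the input alphabet.                        *)
Record dmt : Type := Dmt {
  state : finType;
  srank : state -> nat;
  input : alphabet;
  output : alphabet;
  init : state;
  rhs : state -> symbol -> term (state * nat + symbol);

  init_rank : srank init = 0;
  rhs_pattern : forall q w k, rank_in input w = Some k ->
    pattern (sum_rank (call_rank srank k) (rank_in output)) (srank q) (rhs q w)
}.

(* M_q(s), as a function of q; the [Var] case is irrelevant on trees over the *)
(* input alphabet.                                                            *)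
Fixpoint eval (M : dmt) (s : term symbol) : state M -> term symbol :=
  match s with
  | Var j => fun _ => Var j
  | Op w ss => fun q =>
      subst (fun c => nth (fun=> Var 0) (map (@eval M) ss) c.2 c.1) (rhs q w)
  end.

(* Transductions are identified with their graphs. *)
Definition transduction : Type := set (term symbol * term symbol).

Definition realized (M : dmt) : transduction :=
  [set st | trees (input M) st.1 /\ st.2 = eval st.1 (init M)].

Definition sts_step (M : dmt) (w : symbol) (i : nat) (qs : seq (state M)) :
    seq (state M) :=
  [seq c.1 | c <- left_labels [seq rhs q w | q <- qs] & c.2 == i].

Inductive sts (M : dmt) : set (seq (state M)) :=
| StsInit : sts [:: init M]
| StsStep (w : symbol) (k i : nat) (qs : seq (state M)) :
    rank_in (input M) w = Some k -> i < k -> sts qs -> sts (sts_step w i qs).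

Definition finite_copying (M : dmt) : Prop := finite_set (@sts M).

Definition is_dt (M : dmt) : Prop := forall q : state M, srank q = 0.

Definition DMTfc : set transduction :=
  [set tau | exists M : dmt, finite_copying M /\ realized M = tau].

Definition DTfc : set transduction :=
  [set tau | exists M : dmt, [/\ is_dt M, finite_copying M & realized M = tau]].

(* The class X(C) of all images tau(K) with tau in X and K in C a language    *)
(* over the input alphabet of tau.                                            *)
Definition images (X : set transduction) (C : set language) : set language :=
  [set L | exists tau K, [/\ X tau, C K,
     K `<=` [set s | exists t, tau (s, t)] &
     L = [set t | exists2 s, K s & tau (s, t)]]].

(* Main.v *)
Require Import Defs.
From mathcomp Require Import all_boot classical_sets.
From mathcomp Require Import finmap boolp cardinality.

Set Implicit Arguments.
Unset Strict Implicit.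
Unset Printing Implicit Defensive.

(* A derivation tree of a grammar carries a rule at each node, whose children are the derivation
   trees substituted for the links; such trees form a regular language. The transducer whose states
   are the nonterminals maps a derivation tree to the forest it derives. The state sequences are
   repetition-free because the right-hand sides are uniquely labeled, so there are finitely many.
   Conversely, given a transducer and an automaton, the nonterminals of the grammar are the calls
   occurring in the strings rhs(q_1, w) ... rhs(q_n, w), each paired with an automaton state, and the
   calls to the same subtree y_i form one big nonterminal. A derivation step then mimics an automaton
   transition. Subtrees that are not called disappear from the grammar, so a rule is admitted only
   if the automaton states of all subtrees are reachable. *)

(** * Induction on terms, and concatenations of lists *)

(** Subterms are nested in a list, where the generated induction principle gives no hypothesis; the
    second predicate [Q] carries it through forests. *)
Lemma term_forest_ind (S : Type) (P : term S -> Prop) (Q : seq (term S) -> Prop) :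
  (forall j, P (Var j)) -> (forall s ts, Q ts -> P (Op s ts)) ->
  Q [::] -> (forall t ts, P t -> Q ts -> Q (t :: ts)) -> forall t, P t.
Proof.
move=> PV PO Q0 QS; fix IH 1 => -[j|s ts]; first exact: PV.
by apply: PO; elim: ts => [|t ts IHts] //; apply: QS.
Qed.

Lemma nth_flatten_inj (T : eqType) (ss : seq (seq T)) i j x :
  uniq (flatten ss) -> x \in nth [::] ss i -> x \in nth [::] ss j -> i = j.
Proof.
elim: ss i j => [|s ss IH] [|i] [|j] //=; rewrite cat_uniq => /and3P[us /hasPn dj uss].
- move=> xs xj; have := dj x; rewrite /= xs => /(_ _)/negP[]//.
  have [jlt|jge] := ltnP j (size ss); last by rewrite nth_default in xj.
  by apply/flattenP; exists (nth [::] ss j) => //; apply: mem_nth.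
- move=> xi xs; have := dj x; rewrite /= xs => /(_ _)/negP[]//.
  have [jlt|jge] := ltnP i (size ss); last by rewrite nth_default in xi.
  by apply/flattenP; exists (nth [::] ss i) => //; apply: mem_nth.
- by move=> xi xj; congr _.+1; apply: IH xj.
Qed.

Lemma uniq_flatten_map (I T : eqType) (F : I -> seq T) (s : seq I) :
  uniq s -> {in s, forall i, uniq (F i)} ->
  {in s &, forall i j x, x \in F i -> x \in F j -> i = j} ->
  uniq (flatten (map F s)).
Proof.
elim: s => //= i s IH /andP[is_ us] uF dF.
rewrite cat_uniq uF ?mem_head ?IH // ?andbT /=; last first.
- by move=> a b ha hb; apply: dF; rewrite inE (ha, hb) orbT.
- by move=> a ha; apply: uF; rewrite inE ha orbT.
apply/hasPn => x /flatten_mapP[j js xj]; apply/negP => /= xi.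
by rewrite (dF i j _ _ x) ?mem_head ?inE ?js ?orbT // in is_.
Qed.

(** This evaluates the lookup in [link_subst]: since [m] occurs once in the concatenation, its
    position there falls into the block of [B]. *)
Lemma nth_flatten_map (N : eqType) (T : Type) (d : T) (L : seq (seq N))
    (h : seq N -> N -> T) (B : seq N) (m : N) :
  uniq (flatten L) -> B \in L -> m \in B ->
  nth d (flatten [seq map (h C) C | C <- L]) (index m (flatten L)) = h B m.
Proof.
elim: L => //= C L IH; rewrite cat_uniq => /and3P[_ /hasPn dj uL].
rewrite inE index_cat nth_cat size_map => /orP[/eqP->|BL] mB.
  by rewrite mB index_mem mB (nth_map m) ?index_mem // nth_index.
have mL : m \in flatten L by apply/flattenP; exists B.
rewrite (negbTE (dj _ mL)) ltnNge leq_addr /= addKn; exact: IH.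
Qed.

Lemma seq_choice (I : eqType) (T : Type) (P : I -> T -> Prop) (s : seq I) :
  {in s, forall i, exists x, P i x} ->
  exists xs, size xs = size s /\
    forall i0 x0 j, j < size s -> P (nth i0 s j) (nth x0 xs j).
Proof.
elim: s => [|i s IH] ex; first by exists [::].
have [x Px] := ex i (mem_head _ _).
have [|xs [sz Pxs]] := IH; first by move=> j js; apply: ex; rewrite inE js orbT.
by exists (x :: xs); split=> [|i0 x0 [|j]] //=; [rewrite sz|apply: Pxs].
Qed.

(** * Left labels of forests, and their renaming *)

Arguments left_labels : simpl never.

Section LeftLabels.
Variables N S : Type.
Implicit Types (t : term (N + S)) (ts : seq (term (N + S))).

Lemma left_labels_cons t ts :
  left_labels (t :: ts) = left_labels [:: t] ++ left_labels ts.
Proof. by rewrite /left_labels /= cats0 pmap_cat. Qed.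

Lemma left_labels_inl n ts :
  left_labels [:: Op (inl n) ts] = n :: left_labels ts.
Proof. by rewrite /left_labels /= cats0. Qed.

Lemma left_labels_inr (a : S) ts :
  left_labels [:: Op (inr a : N + S) ts] = left_labels ts.
Proof. by rewrite /left_labels /= cats0. Qed.

Lemma left_labels_flatten ts :
  left_labels ts = flatten [seq left_labels [:: t] | t <- ts].
Proof. by elim: ts => //= t ts IH; rewrite left_labels_cons IH. Qed.

End LeftLabels.

Lemma mem_left_labels (N : eqType) S (t : term (N + S)) ts i n :
  i < size ts -> n \in left_labels [:: nth t ts i] -> n \in left_labels ts.
Proof.
rewrite (left_labels_flatten ts) => it nt.
apply/flattenP; exists (left_labels [:: nth t ts i]) => //.
by rewrite -(nth_map _ [::] (fun t => left_labels [:: t])) // mem_nth ?size_map.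
Qed.

Lemma eq_in_subst (N : eqType) S (h h' : N -> term S) (t : term (N + S)) :
  {in left_labels [:: t], h =1 h'} -> subst h t = subst h' t.
Proof.
move: t; apply: (@term_forest_ind _ _ (fun ts =>
  {in left_labels ts, h =1 h'} -> map (subst h) ts = map (subst h') ts)) => //.
- move=> [n|a] ts IH /=; rewrite ?left_labels_inl ?left_labels_inr => e.
    by rewrite e ?mem_head // IH // => x xs; apply: e; rewrite inE xs orbT.
  by rewrite IH.
- move=> t ts IH IHs; rewrite left_labels_cons => e /=.
  by rewrite IH ?IHs // => x xs; apply: e; rewrite mem_cat xs ?orbT.
Qed.

Lemma ranked_sum_rank_sub (N : eqType) S (rkN rkN' : N -> option nat)
    (rkS rkS' : S -> option nat) (t : term (N + S)) :
  {in left_labels [:: t], forall n k, rkN n = Some k -> rkN' n = Some k} ->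
  (forall a k, rkS a = Some k -> rkS' a = Some k) ->
  ranked (sum_rank rkN rkS) t -> ranked (sum_rank rkN' rkS') t.
Proof.
move=> eN eS; move: eN.
move: t; apply: (@term_forest_ind _ _ (fun ts =>
  {in left_labels ts, forall n k, rkN n = Some k -> rkN' n = Some k} ->
  all (ranked (sum_rank rkN rkS)) ts -> all (ranked (sum_rank rkN' rkS')) ts)) => //.
- move=> [n|a] ts IH /=; rewrite ?left_labels_inl ?left_labels_inr.
  + move=> e /andP[/eqP rk rts]; rewrite (e n _ _ rk) ?mem_head ?eqxx //=.
    by apply: IH rts => m ms; apply: e; rewrite inE ms orbT.
  + by move=> e /andP[/eqP/eS-> rts]; rewrite eqxx IH.
- move=> t ts IH IHs; rewrite left_labels_cons => e /= /andP[rt rts].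
  by rewrite IH ?IHs // => m ms; apply: e; rewrite mem_cat ms ?orbT.
Qed.

Section Relabel.
Variables (N N' S : Type) (f : N -> N').

Fixpoint relabel (t : term (N + S)) : term (N' + S) :=
  match t with
  | Var j => Var j
  | Op (inl n) ts => Op (inl (f n)) (map relabel ts)
  | Op (inr a) ts => Op (inr a) (map relabel ts)
  end.

Lemma vars_relabel t : vars (relabel t) = vars t.
Proof.
move: t; apply: (@term_forest_ind _ _ (fun ts =>
  flatten (map (@vars _) (map relabel ts)) = flatten (map (@vars _) ts))) => //.
- by case.
- by move=> t ts /= -> ->.
Qed.

Lemma ranked_relabel rkN rkS t :
  ranked (sum_rank rkN rkS) (relabel t) = ranked (sum_rank (rkN \o f) rkS) t.
Proof.
move: t; apply: (@term_forest_ind _ _ (fun ts =>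
  all (ranked (sum_rank rkN rkS)) (map relabel ts) =
  all (ranked (sum_rank (rkN \o f) rkS)) ts)) => //.
- by case=> [n|a] ts /= ->; rewrite size_map.
- by move=> t ts /= -> ->.
Qed.

Lemma left_labels_relabel ts :
  left_labels (map relabel ts) = map f (left_labels ts).
Proof.
have H1 t : left_labels [:: relabel t] = map f (left_labels [:: t]).
  move: t; apply: (@term_forest_ind _ _ (fun ts =>
    left_labels (map relabel ts) = map f (left_labels ts))) => //.
  - by case=> [n|a] us IH; rewrite [relabel _]/= !(left_labels_inl, left_labels_inr) IH.
  - by move=> t us IH1 IH2; rewrite /= left_labels_cons IH1 IH2 -map_cat -left_labels_cons.
by elim: ts => //= t ts IH; rewrite left_labels_cons IH H1 -map_cat -left_labels_cons.
Qed.

Lemma subst_relabel (h : N' -> term S) t :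
  subst h (relabel t) = subst (h \o f) t.
Proof.
move: t; apply: (@term_forest_ind _ _ (fun ts =>
  map (subst h) (map relabel ts) = map (subst (h \o f)) ts)) => //.
- by case=> [n|a] ts /= ->.
- by move=> t ts /= -> ->.
Qed.

End Relabel.

Lemma pattern_relabel (N : eqType) N' S (rkN : N -> option nat)
    (rkN' : N' -> option nat) (rkS rkS' : S -> option nat) (f : N -> N') m t :
  {in left_labels [:: t], forall n k, rkN n = Some k -> rkN' (f n) = Some k} ->
  (forall a k, rkS a = Some k -> rkS' a = Some k) ->
  pattern (sum_rank rkN rkS) m t -> pattern (sum_rank rkN' rkS') m (relabel f t).
Proof.
move=> eN eS /andP[rt vt]; rewrite /pattern vars_relabel vt ranked_relabel andbT.
exact: ranked_sum_rank_sub rt.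
Qed.

(** * Numbering of calls in preorder *)

Section Number.
Variables C S : Type.

Section Forest.
Variable preorder_number : nat -> term (C + S) -> term (nat + S).
(** The traversal of forests takes the function on trees as a parameter, so that the nested
    recursion of [preorder_number] is structural although a counter is threaded through the list.
    Numbering separates repeated occurrences of the same call, as a uniquely labeled right-hand side
    requires. *)
Fixpoint number_with n (ts : seq (term (C + S))) : seq (term (nat + S)) :=
  if ts is t :: ts' then
    preorder_number n t :: number_with (n + size (left_labels [:: t])) ts'
  else [::].
End Forest.

Fixpoint preorder_number (n : nat) (t : term (C + S)) : term (nat + S) :=
  match t with
  | Var j => Var j
  | Op (inl c) ts => Op (inl n) (number_with preorder_number n.+1 ts)
  | Op (inr a) ts => Op (inr a) (number_with preorder_number n ts)
  end.

Notation numbers := (number_with preorder_number).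

Lemma size_numbers n ts : size (numbers n ts) = size ts.
Proof. by elim: ts n => //= t ts IH n; rewrite IH. Qed.

Lemma left_labels_numbers n ts :
  left_labels (numbers n ts) = iota n (size (left_labels ts)).
Proof.
have H1 t : forall n, left_labels [:: preorder_number n t] = iota n (size (left_labels [:: t])).
  move: t; apply: (@term_forest_ind _ _ (fun ts => forall n,
    left_labels (numbers n ts) = iota n (size (left_labels ts)))) => //.
  - by case=> [c|a] us IH m; rewrite [preorder_number _ _]/= !(left_labels_inl, left_labels_inr) IH.
  - move=> t us IH1 IH2 m; rewrite /= left_labels_cons IH1 IH2.
    by rewrite [in RHS]left_labels_cons size_cat iotaD.
elim: ts n => //= t ts IH n; rewrite left_labels_cons H1 IH.
by rewrite [in RHS]left_labels_cons size_cat iotaD.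
Qed.

Lemma relabel_numbers c0 n f ts :
  (forall j, j < size (left_labels ts) -> f (n + j) = nth c0 (left_labels ts) j) ->
  map (relabel f) (numbers n ts) = ts.
Proof.
pose ok n cs := forall j, j < size cs -> f (n + j) = nth c0 cs j.
(* The numbers used in a tree and in the forest after it are adjacent intervals, so the hypothesis
   on [f] splits along the concatenation. *)
have okD m cs cs' : ok m (cs ++ cs') -> ok m cs /\ ok (m + size cs) cs'.
  move=> o; split=> j jlt.
    by rewrite o ?nth_cat ?jlt // size_cat ltn_addr.
  by rewrite -addnA o ?nth_cat ?size_cat ?ltn_add2l // ltnNge leq_addr /= addKn.
have H1 t : forall n, ok n (left_labels [:: t]) -> relabel f (preorder_number n t) = t.
  move: t; apply: (@term_forest_ind _ _ (fun ts => forall n, ok n (left_labels ts) ->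
    map (relabel f) (numbers n ts) = ts)) => //.
  - case=> [c|a] us IH m; rewrite /= ?left_labels_inl ?left_labels_inr => o.
      have := o 0 isT; rewrite addn0 /= => ->; rewrite IH // => j jlt.
      by rewrite addSnnS o.
    by rewrite IH.
  - move=> t us IH1 IH2 m; rewrite left_labels_cons => /okD[o1 o2] /=.
    by rewrite IH1 ?IH2.
rewrite -/(ok n _); elim: ts n => //= t ts IH n.
by rewrite left_labels_cons => /okD[o1 o2]; rewrite H1 ?IH.
Qed.

End Number.
Notation numbers := (number_with (@preorder_number _ _)).

(** Trades the positional lookup of [link_subst] for a substitution by a plain function, the form in
    which [eval] is written. *)
Lemma eq_in_link_subst (N : eqType) S (L : seq (seq N)) (f : seq N -> seq (term S))
    (h : seq N -> N -> term S) (g : N -> term S) t :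
  uniq (flatten L) -> {in L, forall B, f B = map (h B) B} ->
  {in left_labels [:: t], forall m, exists B, [/\ B \in L, m \in B & g m = h B m]} ->
  link_subst L f t = subst g t.
Proof.
move=> uL fE gE; apply: eq_in_subst => m /gE[B [BL mB ->]].
by rewrite ((eq_in_map f (fun C => map (h C) C) L).1 fE) (nth_flatten_map _ _ uL BL).
Qed.

(** * Finite ranked alphabets and fresh symbols *)

Definition alphabet_of (rk : nat -> option nat) (n : nat) : alphabet :=
  foldr (fun w Om => if rk w is Some k then Om.[w <- k]%fmap else Om) [fmap]%fmap (iota 0 n).

Lemma rank_alphabet_of rk n w :
  rank_in (alphabet_of rk n) w = if w < n then rk w else None.
Proof.
rewrite /alphabet_of /rank_in -[w < n](mem_iota 0 n w).
elim: (iota 0 n) => [|v vs IH] /=; first by rewrite fnd_fmap0.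
rewrite inE; case: eqP => [<-|/eqP/negbTE ne] /=.
  by case rw: (rk w) => [k|]; rewrite ?fnd_set ?eqxx // IH rw if_same.
by case: (rk v) => [k|] //; rewrite fnd_set ne.
Qed.

(** Every number from this bound on is fresh for the alphabet. *)
Definition alphabet_bound (Om : alphabet) : nat := (\max_(a <- domf Om) a).+1.

Lemma alphabet_boundP Om a k : rank_in Om a = Some k -> a < alphabet_bound Om.
Proof.
move=> h; rewrite ltnS; apply: (@leq_bigmax_seq _ _ xpredT id) => //.
by apply: contraT => na; rewrite /rank_in not_fnd in h.
Qed.

Lemma all2_nth (A B : Type) (p : A -> B -> bool) (s : seq A) (t : seq B) :
  all2 p s t -> size s = size t /\
  forall a b i, i < size s -> p (nth a s i) (nth b t i).
Proof.
elim: s t => [|x s IH] [|y t] //= /andP[pxy /IH[-> h]].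
by split=> // a b [|i] // ilt; apply: h.
Qed.

Lemma pattern_relabelE N N' S (rkN : N' -> option nat) (rkS : S -> option nat) (f : N -> N') m t :
  pattern (sum_rank rkN rkS) m (relabel f t) = pattern (sum_rank (rkN \o f) rkS) m t.
Proof. by rewrite /pattern ranked_relabel vars_relabel. Qed.

Lemma eq_map_left_labels (N : eqType) S T (f g : term (N + S) -> T) ts :
  (forall t, {subset left_labels [:: t] <= left_labels ts} -> f t = g t) ->
  map f ts = map g ts.
Proof.
elim: ts => //= t ts IH e; rewrite e ?IH //.
  by move=> u sub; apply: e => x /sub xs; rewrite left_labels_cons mem_cat xs orbT.
by move=> x xs; rewrite left_labels_cons mem_cat xs.
Qed.

Lemma ranked_left_labels (N : eqType) S (rkN : N -> option nat) (rkS : S -> option nat) t n :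
  ranked (sum_rank rkN rkS) t -> n \in left_labels [:: t] -> rkN n.
Proof.
move: t; apply: (@term_forest_ind _ _ (fun ts =>
  all (ranked (sum_rank rkN rkS)) ts -> n \in left_labels ts -> rkN n)) => //.
- case=> [m|a] us IH; rewrite !(left_labels_inl, left_labels_inr) /= => /andP[/eqP rk /IH] //.
  by rewrite inE => h /orP[/eqP->|//]; rewrite rk.
- move=> t us IH1 IH2 /= /andP[/IH1 h1 /IH2 h2].
  by rewrite left_labels_cons mem_cat => /orP[].
Qed.

Lemma nth_all2 (A B : Type) (p : A -> B -> bool) (s : seq A) (t : seq B) :
  size s = size t -> (forall a b i, i < size s -> p (nth a s i) (nth b t i)) -> all2 p s t.
Proof.
elim: s t => [|x s IH] [|y t] //= [sz] h.
by rewrite (h x y 0) //= IH // => a b i ilt; apply: (h a b i.+1).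
Qed.

(** * From a grammar to a transducer on its derivation trees *)

Section GrammarToTransducer.
Variable G : mcftg.
Implicit Types (r : rule G) (n : nonterm G) (B : seq (nonterm G)).

(** Input symbols are natural numbers, so a rule is represented by its position in the enumeration
    of all rules. *)
Definition rule_code r : symbol := index r (enum (rule G)).

Definition rule_decode (w : symbol) : option (rule G) := onth (enum (rule G)) w.

Lemma rule_codeK r : rule_decode (rule_code r) = Some r.
Proof.
rewrite /rule_decode onthE /rule_code (nth_map r) ?nth_index ?index_mem ?mem_enum //.
Qed.

Definition derivation_alphabet : alphabet :=
  alphabet_of (fun w => omap (size \o @rule_links G) (rule_decode w)) (size (enum (rule G))).

Lemma rank_derivation_alphabet w :
  rank_in derivation_alphabet w = omap (size \o @rule_links G) (rule_decode w).
Proof.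
by rewrite rank_alphabet_of; case: ltnP => // /onth_default e; rewrite /rule_decode e.
Qed.

(** The state at a node is the rule applied there; a transition checks that the rules at the
    children have the links as their left-hand sides, in order. *)
Definition derivation_automaton : nfta :=
  @Nfta (rule G) derivation_alphabet
    (fun w ps r => (w == rule_code r) && (map (@rule_lhs G) ps == rule_links r))
    (fun r => rule_lhs r == [:: start G]).

Definition dummy_base : nat := alphabet_bound (terminals G).
Definition max_nrank : nat := \max_(n : nonterm G) nrank n.

(* The transducer is total, so it also needs right-hand sides for the states outside rule_lhs r;
   each rank k gets a fresh output symbol for this purpose. *)
Definition dummy (k : nat) : term (nonterm G * nat + symbol) :=
  Op (inr (dummy_base + k)) (map Var (iota 0 k)).

Definition dummy_alphabet : alphabet :=
  alphabet_of (fun a => if a < dummy_base then rank_in (terminals G) a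
                        else Some (a - dummy_base)) (dummy_base + max_nrank.+1).

Lemma rank_terminals_dummy a k :
  rank_in (terminals G) a = Some k -> rank_in dummy_alphabet a = Some k.
Proof.
move=> rk; have alt := alphabet_boundP rk.
by rewrite rank_alphabet_of alt (ltn_addr _ alt).
Qed.

Lemma pattern_dummy rkC n :
  pattern (sum_rank rkC (rank_in dummy_alphabet)) (nrank n) (dummy (nrank n)).
Proof.
rewrite /pattern /= rank_alphabet_of ltn_add2l ltnS leq_bigmax ltnNge leq_addr /=.
rewrite addKn size_map size_iota eqxx -map_comp /= all_map all_predT /=.
by elim: (iota _ _) => //= j s IH; rewrite perm_cons.
Qed.

(** The subtree to call is the derivation tree of the link containing [n], which is unique because
    the links are disjoint. *)
Definition rule_call r n : nonterm G * nat :=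
  (n, find (fun B => n \in B) (rule_links r)).

Definition rule_body r n : term (nonterm G + symbol) :=
  nth (Var 0) (rule_rhs r) (index n (rule_lhs r)).

Definition derivation_rhs n (w : symbol) : term (nonterm G * nat + symbol) :=
  if rule_decode w is Some r then
    if n \in rule_lhs r then relabel (rule_call r) (rule_body r n)
    else dummy (nrank n)
  else dummy (nrank n).

Lemma size_rule_rhs r : size (rule_rhs r) = size (rule_lhs r).
Proof. by have [-> _] := all2_nth (rule_rhs_pattern r). Qed.

Lemma has_link r n :
  n \in left_labels (rule_rhs r) -> has (fun B => n \in B) (rule_links r).
Proof. by rewrite -rule_links_cover => /flattenP[B BL nB]; apply/hasP; exists B. Qed.

Lemma mem_rule_body r n m : n \in rule_lhs r ->
  m \in left_labels [:: rule_body r n] -> m \in left_labels (rule_rhs r).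
Proof. by move=> nr; apply: mem_left_labels; rewrite size_rule_rhs index_mem. Qed.

Lemma derivation_rhs_pattern n w k : rank_in derivation_alphabet w = Some k ->
  pattern (sum_rank (call_rank (@nrank G) k) (rank_in dummy_alphabet)) (nrank n)
    (derivation_rhs n w).
Proof.
rewrite rank_derivation_alphabet /derivation_rhs.
case: rule_decode => //= r [<-]; case: ifP => [nr|_]; last exact: pattern_dummy.
have [_ /(_ n (Var 0) (index n (rule_lhs r)))] := all2_nth (rule_rhs_pattern r).
rewrite index_mem nth_index // => /(_ nr).
apply: pattern_relabel; last exact: rank_terminals_dummy.
by move=> m /(mem_rule_body nr) mr j [<-]; rewrite /call_rank /= -has_find has_link.
Qed.

Definition derivation_dmt : dmt :=
  Dmt (start_rank G) derivation_rhs_pattern.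

(** Distinct states select distinct trees of the right-hand side of the rule, and no nonterminal
    occurs twice in these trees together. Dummies contain no calls. *)
Lemma derivation_sts_uniq qs : @sts derivation_dmt qs -> uniq qs.
Proof.
elim=> // w k i {}qs rkw ik _ uqs; rewrite /sts_step.
move: rkw; rewrite /= rank_derivation_alphabet.
case dw: rule_decode => [r|] //= _.
pose F n := if n \in rule_lhs r then left_labels [:: rule_body r n] else [::].
have -> : left_labels [seq derivation_rhs q w | q <- qs] =
          [seq rule_call r m | m <- flatten [seq F q | q <- qs]].
  rewrite left_labels_flatten map_flatten -!map_comp; congr flatten.
  apply: eq_map => q; rewrite /= /derivation_rhs dw /F.
  case: ifP => _; first exact: (left_labels_relabel _ [:: _]).
  rewrite /dummy left_labels_inr /=.
  by elim: (iota 0 _) => //= j s IH; rewrite left_labels_cons IH.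
(* The first component of a call gives back its nonterminal, so selecting calls by child amounts to
   filtering the list of nonterminals. *)
rewrite filter_map -map_comp /= map_id filter_uniq //.
have ur := rule_rhs_uniq r; rewrite left_labels_flatten in ur.
have FE q : F q = nth [::] [seq left_labels [:: t] | t <- rule_rhs r] (index q (rule_lhs r)).
  rewrite /F -index_mem -size_rule_rhs; case: ltnP => h; first by rewrite (nth_map (Var 0)).
  by rewrite nth_default ?size_map.
apply: uniq_flatten_map => //.
- move=> q _; rewrite FE.
  set s := map _ _ in ur *; elim: s (index _ _) ur => [|x s IH] [|j] //=;
    by rewrite cat_uniq => /and3P[ux _ /IH].
- move=> q q' _ _ m mq mq'.
  have Fr p : m \in F p -> p \in rule_lhs r by rewrite /F; case: ifP.
  have h := @nth_flatten_inj _ _ (index q (rule_lhs r)) (index q' (rule_lhs r)) m ur.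
  by rewrite -!FE in h; apply: index_inj (Fr _ mq) (Fr _ mq') (h mq mq').
Qed.

(** A repetition-free sequence is no longer than the number of nonterminals, and there are finitely
    many sequences of bounded length. *)
Lemma finite_copying_derivation_dmt : finite_copying derivation_dmt.
Proof.
apply: (@sub_finite_set _ _ [set` map val (enum {: #|nonterm G|.-bseq (nonterm G)})]);
  last exact: finite_seq.
move=> qs /derivation_sts_uniq uqs /=.
have sz : size qs <= #|nonterm G| by rewrite -(card_uniqP uqs) max_card.
by apply/mapP; exists (Bseq sz); rewrite ?mem_enum.
Qed.

(** One derivation step is one evaluation step: both substitute into the same trees, provided that
    each call reaches the child belonging to its link. Both inclusions rest on this. *)
Lemma eval_derivation r ds (f : seq (nonterm G) -> seq (term symbol)) :
  {in rule_links r, forall B,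
    f B = map (@eval derivation_dmt (nth (Var 0) ds (index B (rule_links r)))) B} ->
  size ds = size (rule_links r) ->
  map (link_subst (rule_links r) f) (rule_rhs r) =
  map (@eval derivation_dmt (Op (rule_code r) ds)) (rule_lhs r).
Proof.
move=> fE sz; set L := rule_links r in fE sz *.
apply: (@eq_from_nth _ (Var 0)); first by rewrite !size_map size_rule_rhs.
rewrite size_map size_rule_rhs => j jlt.
have n0 : nonterm G by case: (rule_lhs r) jlt.
rewrite (nth_map (Var 0)) ?size_rule_rhs // (nth_map n0) //=.
rewrite /derivation_rhs rule_codeK mem_nth // subst_relabel /rule_body index_uniq //; last first.
  exact: bignt_uniq (rule_lhs_bignt r).
apply: (eq_in_link_subst (rule_links_disjoint r) fE) => m mt.
have hm : has (fun B => m \in B) L.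
  by apply: has_link; apply: mem_left_labels mt; rewrite size_rule_rhs.
set B := nth [::] L (find (fun B => m \in B) L).
have BL : B \in L by rewrite mem_nth // -has_find.
have mB : m \in B := nth_find [::] hm.
have bB : B \in bignt G := rule_links_bignt BL.
exists B; split=> //=.
(* [index] comes from the hypothesis on [f], [find] from the calls; they agree because [m] lies in
   both links and the links are disjoint. *)
suff -> : index B L = find (fun B => m \in B) L.
  by rewrite (nth_map (Var 0)) // sz -has_find.
have i1 : index B L < size L by rewrite index_mem.
by apply: (@nth_flatten_inj _ _ _ _ m (rule_links_disjoint r)); rewrite ?nth_index.
Qed.

Lemma generates_derivation A fs : @generates G A fs ->
  exists d r, [/\ @run derivation_automaton d r, rule_lhs r = A &
                  fs = map (@eval derivation_dmt d) A].
Proof.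
elim=> {A fs} r f _ IH.
(* The induction hypothesis gives a tree and a rule for each link separately; they are chosen
   simultaneously to form the list of children. *)
have [|xs [sz xsP]] := @seq_choice _ (term symbol * rule G) (fun B x =>
  [/\ @run derivation_automaton x.1 x.2, rule_lhs x.2 = B &
      f B = map (@eval derivation_dmt x.1) B]) (rule_links r).
  by move=> B /IH[d [q [h1 h2 h3]]]; exists (d, q).
have {}xsP := xsP [::] (Var 0, r).
exists (Op (rule_code r) (unzip1 xs)), r; split=> //; last first.
  apply: eval_derivation; last by rewrite size_map.
  move=> B BL; have := BL; rewrite -index_mem => ilt.
  have [_ _] := xsP _ ilt; rewrite nth_index // => ->.
  by rewrite (nth_map (Var 0, r)) ?sz.
apply: (@Run derivation_automaton _ _ (unzip2 xs)); rewrite ?size_map //.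
- by rewrite /= rank_derivation_alphabet rule_codeK /= sz.
- move=> i ilt; have := xsP i; rewrite -sz => /(_ ilt)[h _ _].
  by rewrite !(nth_map (Var 0, r)).
- rewrite /= eqxx /=; apply/eqP/(@eq_from_nth _ [::]); rewrite !size_map // => i ilt.
  have := xsP i; rewrite -sz => /(_ ilt)[_ h _].
  by rewrite -map_comp (nth_map (Var 0, r)).
Qed.

Lemma derivation_generates d r : @run derivation_automaton d r ->
  generates (rule_lhs r) (map (@eval derivation_dmt d) (rule_lhs r)).
Proof.
elim=> {d r} w ds ps r rkw szp _ IH /= /andP[/eqP wE /eqP psE].
have szL : size ds = size (rule_links r) by rewrite -psE size_map szp.
pose f B := map (@eval derivation_dmt (nth (Var 0) ds (index B (rule_links r)))) B.
rewrite wE -(@eval_derivation r ds f) //.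
apply: Generates => B BL; have := BL; rewrite -index_mem -szL => ilt.
have := IH _ ilt; rewrite -(nth_map _ [::]) ?szp // psE nth_index //.
Qed.

(** No run exists on a variable and every step of a run checks the rank; thus accepted derivation
    trees lie in the domain of the transducer. *)
Lemma run_trees A (s : term symbol) p : @run A s p -> trees (aalphabet A) s.
Proof.
elim=> {s p} w ts ps p rk _ _ IH _.
rewrite /trees /= /pattern /= rk eqxx /=.
have {}IH i : i < size ts -> ranked (rank_in (aalphabet A)) (nth (Var 0) ts i) /\ 
   vars (nth (Var 0) ts i) = [::].
  by move=> /IH/andP[-> /perm_nilP].
have -> : flatten (map (@vars symbol) ts) = [::].
  elim: ts {rk} IH => //= t ts IHs IH.
  have [/= _ ->] := IH 0 isT; rewrite IHs // => i ilt; exact: (IH i.+1).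
by rewrite andbT; apply/(all_nthP (Var 0)) => i /IH[].
Qed.

Lemma mcftg_language_derivation : mcftg_language G =
  [set t | exists2 s, nfta_language derivation_automaton s &
           realized derivation_dmt (s, t)]%classic.
Proof.
apply/seteqP; split=> t.
  move=> /generates_derivation[d [r [rd lr [->]]]].
  exists d; first by exists r => //=; rewrite lr eqxx.
  by split=> //; exact: run_trees rd.
case=> d [r /= /eqP lr rd] [_ /= ->].
by have := derivation_generates rd; rewrite lr.
Qed.

End GrammarToTransducer.

Lemma MCFT_sub_images : (MCFT `<=` images DMTfc RT)%classic.
Proof.
move=> _ [G <-]; exists (realized (derivation_dmt G)), (nfta_language (derivation_automaton G)).
split; last exact: mcftg_language_derivation.
- exists (derivation_dmt G); split=> //; exact: finite_copying_derivation_dmt.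
- by exists (derivation_automaton G).
- move=> s [p _ rp]; exists (@eval (derivation_dmt G) s (start G)).
  by split=> //; exact: run_trees rp.
Qed.

(** States keep the ranks of the nonterminals, so the same transducer is top-down when the grammar
    is an MRTG. *)
Lemma MRT_sub_images : (MRT `<=` images DTfc RT)%classic.
Proof.
move=> _ [G [mG <-]].
exists (realized (derivation_dmt G)), (nfta_language (derivation_automaton G)).
split; last exact: mcftg_language_derivation.
- exists (derivation_dmt G); split=> //; exact: finite_copying_derivation_dmt.
- by exists (derivation_automaton G).
- move=> s [p _ rp]; exists (@eval (derivation_dmt G) s (start G)).
  by split=> //; exact: run_trees rp.
Qed.

(** * From a transducer and an automaton to a grammar: nonterminals and contexts *)

Section TransducerToGrammar.
Variables (M : dmt) (A : nfta) (K : nat).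

Local Notation P := (astate A).
Local Notation Q := (state M).
Local Notation q0 := (init M, 0).

Definition calls (qs : seq Q) (w : symbol) : seq (Q * nat) :=
  left_labels [seq rhs q w | q <- qs].

Definition symbol_bound : nat := alphabet_bound (input M).
Local Notation W := 'I_symbol_bound.

(** This bound and the next make the types of contexts and nonterminals finite. *)
Definition arity_bound : nat := \max_(w : W) odflt 0 (rank_in (input M) w).

Definition calls_bound : nat := \max_(x : K.-bseq Q * W) size (calls x.1 x.2).

(* [Some (p, qs, w, g)] stands for the g-th call in rhs(q_1, w) ... rhs(q_n, w), qs = q_1 ... q_n,
   when it is applied to a subtree with automaton state p. *)
Definition call_nonterm : finType :=
  option (option P * K.-bseq Q * W * 'I_calls_bound.+1).
(** A context names a candidate big nonterminal: [Some (p, qs, w, i)] that of all calls to subtree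
    [i], counted from 0, and [None] the initial one. *)
Definition context : finType :=
  option (option P * K.-bseq Q * W * 'I_arity_bound.+1).
Implicit Types (n : call_nonterm) (c : context).

Definition nonterm_state n : Q :=
  if n is Some (_, qs, w, g) then (nth q0 (calls qs w) g).1 else init M.

Definition nonterm_child n : nat :=
  if n is Some (_, qs, w, g) then (nth q0 (calls qs w) g).2 else 0.

Definition nonterm_context n : context :=
  if n is Some (p, qs, w, g) then Some (p, qs, w, inord (nonterm_child n)) else None.

Definition context_states c : seq Q :=
  if c is Some (_, qs, w, i) then sts_step w i qs else [:: init M].

Definition context_nonterms c : seq call_nonterm :=
  if c is Some (p, qs, w, i) then
    [seq Some (p, qs, w, inord g) | g <- iota 0 (size (calls qs w)) &
                                    (nth q0 (calls qs w) g).2 == i]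
  else [:: None].

Lemma size_calls (qs : K.-bseq Q) (w : W) : size (calls qs w) <= calls_bound.
Proof. exact: (leq_bigmax (qs, w)). Qed.

Lemma call_lt (qs : K.-bseq Q) (w : W) g : g < size (calls qs w) -> g < calls_bound.+1.
Proof. by move=> h; rewrite ltnS (leq_trans (ltnW h)) // size_calls. Qed.

(** A nonterminal determines its context, hence distinct contexts have disjoint sequences of
    nonterminals. *)
Lemma nonterm_contextK c n : n \in context_nonterms c -> nonterm_context n = c.
Proof.
case: c => [[[[p qs] w] i]|]; last by rewrite inE => /eqP->.
case/mapP => g; rewrite mem_filter mem_iota add0n => /andP[/eqP gi /= glt] -> /=.
by rewrite inordK ?(call_lt glt) // gi inord_val.
Qed.

Lemma sts_stepE w i qs : sts_step w i qs =
  [seq (nth q0 (calls qs w) g).1 | g <- iota 0 (size (calls qs w)) &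
                                   (nth q0 (calls qs w) g).2 == i].
Proof.
rewrite /sts_step -/(calls qs w) -[X in filter _ X](mkseq_nth q0) /mkseq.
by rewrite filter_map -map_comp.
Qed.

Lemma map_nonterm_state c : map nonterm_state (context_nonterms c) = context_states c.
Proof.
case: c => [[[[p qs] w] i]|] //=; rewrite sts_stepE -map_comp.
apply/eq_in_map => g; rewrite mem_filter mem_iota add0n => /andP[_ /= glt].
by rewrite inordK ?(call_lt glt).
Qed.

Lemma size_context_nonterms c : size (context_nonterms c) = size (context_states c).
Proof. by rewrite -map_nonterm_state size_map. Qed.

Lemma uniq_context_nonterms c : uniq (context_nonterms c).
Proof.
case: c => [[[[p qs] w] i]|] //=; rewrite map_inj_in_uniq ?filter_uniq ?iota_uniq //.
move=> g g'; rewrite !mem_filter !mem_iota !add0n => /andP[_ /= glt] /andP[_ /= glt'].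
by case=> /(congr1 val); rewrite /= !inordK ?(call_lt glt) ?(call_lt glt').
Qed.

(** Contexts without calls all give the empty sequence and must be excluded; otherwise a common
    nonterminal determines the context. *)
Lemma context_nonterms_inj c c' : context_states c != [::] ->
  context_nonterms c =i context_nonterms c' -> c = c'.
Proof.
move=> ne e; have : 0 < size (context_nonterms c).
  by rewrite size_context_nonterms; case: context_states ne.
case E: (context_nonterms c) => [|n s] // _.
have nc : n \in context_nonterms c by rewrite E mem_head.
by rewrite -(nonterm_contextK nc); apply: nonterm_contextK; rewrite -e.
Qed.

(** * Rules of the grammar *)

(** The automaton and the transducer may have different alphabets, so the ranks are checked in
    both. *)
Definition accepted (s : term symbol) (p : P) : Prop :=
  run s p /\ ranked (rank_in (input M)) s.

(** The state in a context is optional because it is found by [onth], which needs no default element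
    of the possibly empty type of states. *)
Definition context_ok c p : bool :=
  if c is Some (p', _, _, _) then p' == Some p else final p.

(** The context must supply a nonempty left-hand side that fits the bound [K]. Reachability of the
    states is turned into a boolean classically, as the rules have to form a finite type. *)
Definition call_rule_valid (x : context * W * arity_bound.-bseq P) : bool :=
  let: (c, w, ps) := x in
  [&& 0 < size (context_states c) <= K,
      rank_in (aalphabet A) w == Some (size ps), rank_in (input M) w == Some (size ps),
      [exists p, context_ok c p && trans w ps p] &
      all (fun p => `[< exists s, accepted s p >]) ps].

Definition call_rule : finType := {x | call_rule_valid x}.
Implicit Types (r : call_rule).

Definition rule_context r : context := (val r).1.1.
Definition rule_symbol r : W := (val r).1.2.
Definition rule_states r : seq P := (val r).2.

Lemma call_ruleP r :
  [/\ 0 < size (context_states (rule_context r)), size (context_states (rule_context r)) <= K,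
      rank_in (aalphabet A) (rule_symbol r) = Some (size (rule_states r)),
      rank_in (input M) (rule_symbol r) = Some (size (rule_states r)) &
      (exists2 p, context_ok (rule_context r) p & trans (rule_symbol r) (rule_states r) p) /\
      forall p, p \in rule_states r -> exists s, accepted s p].
Proof.
case: r => -[[c w] ps] /= v; rewrite /rule_context /rule_symbol /rule_states /=.
case/and5P: (v) => /andP[h1 h2] /eqP h3 /eqP h4 /existsP[p /andP[h5 h6]] /allP h7.
by split=> //; split; [exists p|move=> q /h7/asboolP].
Qed.

Definition rule_calls r := calls (context_states (rule_context r)) (rule_symbol r).

Definition rule_nonterm r (g : nat) : call_nonterm :=
  Some (onth (rule_states r) (nth q0 (rule_calls r) g).2,
        insub_bseq K (context_states (rule_context r)), rule_symbol r, inord g).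

Definition rule_child r (i : nat) : context :=
  Some (onth (rule_states r) i,
        insub_bseq K (context_states (rule_context r)), rule_symbol r, inord i).

(** A common source of both kinds of right-hand sides: renaming the numbers to calls gives those of
    the transducer, renaming them by [rule_nonterm] those of the grammar. *)
Definition rule_forest r : seq (term (nat + symbol)) :=
  numbers 0 [seq rhs q (rule_symbol r) | q <- context_states (rule_context r)].

(** A subtree that is never called would give an empty link, which is no big nonterminal. *)
Definition live_children r : seq nat :=
  [seq i <- iota 0 (size (rule_states r)) | context_states (rule_child r i) != [::]].

(** The length bound in a valid rule keeps [insub_bseq] from returning its default. *)
Lemma rule_bseqK r :
  (insub_bseq K (context_states (rule_context r)) : seq Q) = context_states (rule_context r).
Proof. by case: (call_ruleP r) => _ h _ _ _; rewrite /insub_bseq insubdK. Qed.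

Lemma rule_arity r : size (rule_states r) <= arity_bound.
Proof. exact: size_bseq. Qed.

Lemma inord_child r i : i < size (rule_states r) -> @inord arity_bound i = i :> nat.
Proof. by move=> h; rewrite inordK // ltnS (leq_trans (ltnW h)) ?rule_arity. Qed.

Lemma inord_call r g : g < size (rule_calls r) -> @inord calls_bound g = g :> nat.
Proof. by rewrite /rule_calls -rule_bseqK => /call_lt h; rewrite inordK. Qed.

Lemma rule_child_states r i : i < size (rule_states r) ->
  context_states (rule_child r i) = sts_step (rule_symbol r) i (context_states (rule_context r)).
Proof. by move=> h; rewrite /= rule_bseqK (inord_child h). Qed.

Lemma rule_child_nonterms r i : i < size (rule_states r) ->
  context_nonterms (rule_child r i) =
  [seq rule_nonterm r g | g <- iota 0 (size (rule_calls r)) & (nth q0 (rule_calls r) g).2 == i].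
Proof.
move=> h; rewrite /= rule_bseqK -/(rule_calls r) (inord_child h).
by apply/eq_in_map => g; rewrite mem_filter => /andP[/eqP <-].
Qed.

Lemma rule_nonterm_state r g : g < size (rule_calls r) ->
  nonterm_state (rule_nonterm r g) = (nth q0 (rule_calls r) g).1.
Proof. by move=> h; rewrite /= rule_bseqK -/(rule_calls r) (inord_call h). Qed.

Lemma rule_nonterm_child r g : g < size (rule_calls r) ->
  nonterm_child (rule_nonterm r g) = (nth q0 (rule_calls r) g).2.
Proof. by move=> h; rewrite /= rule_bseqK -/(rule_calls r) (inord_call h). Qed.

Lemma rule_call_child r g : g < size (rule_calls r) ->
  (nth q0 (rule_calls r) g).2 < size (rule_states r).
Proof.
move=> /(mem_nth q0); move: (nth _ _ _) => x.
rewrite /rule_calls /calls left_labels_flatten -map_comp => /flatten_mapP[q _ /= xq].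
have [_ _ _ rk _] := call_ruleP r.
have /andP[/ranked_left_labels/(_ xq) + _] := rhs_pattern q rk.
by rewrite /call_rank; case: ifP.
Qed.

Lemma rule_forestE r : map (relabel (nth q0 (rule_calls r))) (rule_forest r) =
  [seq rhs q (rule_symbol r) | q <- context_states (rule_context r)].
Proof. exact: relabel_numbers. Qed.

Lemma left_labels_rule_forest r : left_labels (rule_forest r) = iota 0 (size (rule_calls r)).
Proof. exact: left_labels_numbers. Qed.

(** * Assembly of the grammar *)

Definition call_links r : seq (seq call_nonterm) :=
  [seq context_nonterms (rule_child r i) | i <- live_children r].

Definition call_rhs r : seq (term (call_nonterm + symbol)) :=
  map (relabel (rule_nonterm r)) (rule_forest r).

(** A grammar needs a terminal of positive rank, which the output alphabet may lack; a fresh unary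
    symbol is added. *)
Definition call_terminals : alphabet :=
  alphabet_of (fun a => if a < alphabet_bound (output M) then rank_in (output M) a else Some 1)
    (alphabet_bound (output M)).+1.

Lemma rank_call_terminals a k :
  rank_in (output M) a = Some k -> rank_in call_terminals a = Some k.
Proof.
by move=> rk; have alt := alphabet_boundP rk; rewrite rank_alphabet_of alt ltnS (ltnW alt).
Qed.

Definition call_bignt : seq (seq call_nonterm) :=
  [seq context_nonterms c | c <- enum {: context} & context_states c != [::]].

Lemma call_bigntP B : reflect (exists2 c, context_states c != [::] & B = context_nonterms c)
  (B \in call_bignt).
Proof.
apply: (iffP mapP) => [[c]|[c ne ->]].
  by rewrite mem_filter => /andP[ne _] ->; exists c.
by exists c => //; rewrite mem_filter ne mem_enum.
Qed.

Definition call_nrank n : nat := srank (nonterm_state n).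

Lemma call_bignt_nonempty : [::] \notin call_bignt.
Proof.
apply/negP => /call_bigntP[c ne e].
by rewrite -map_nonterm_state -e in ne.
Qed.

Lemma call_bignt_uniq : {in call_bignt, forall B, uniq B}.
Proof. by move=> _ /call_bigntP[c _ ->]; apply: uniq_context_nonterms. Qed.

Lemma call_bignt_occ : {in call_bignt &, forall B C, B =i C -> B = C}.
Proof.
by move=> _ _ /call_bigntP[c ne ->] /call_bigntP[c' _ ->] /(context_nonterms_inj ne) ->.
Qed.

Lemma call_terminals_rank : exists a k, rank_in call_terminals a = Some k.+1.
Proof.
by exists (alphabet_bound (output M)), 0; rewrite rank_alphabet_of ltnSn ltnn.
Qed.

Lemma call_start_bignt : [:: None] \in call_bignt.
Proof. by apply/call_bigntP; exists None. Qed.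

Lemma call_lhs_bignt r : context_nonterms (rule_context r) \in call_bignt.
Proof.
have [h _ _ _ _] := call_ruleP r; apply/call_bigntP.
by exists (rule_context r) => //; case: context_states h.
Qed.

Lemma size_rule_forest r : size (rule_forest r) = size (context_states (rule_context r)).
Proof. by rewrite size_numbers size_map. Qed.

(** The pattern property is pulled back from [rhs] to the numbered forest and pushed forward along
    [rule_nonterm], which preserves ranks. *)
Lemma call_rhs_pattern r :
  all2 (fun n u => pattern (sum_rank (fun m => Some (call_nrank m)) (rank_in call_terminals))
                           (call_nrank n) u)
       (context_nonterms (rule_context r)) (call_rhs r).
Proof.
have [_ _ _ rk _] := call_ruleP r.
apply: nth_all2; first by rewrite size_context_nonterms size_map size_rule_forest.
move=> n u i; rewrite size_context_nonterms => ilt.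
rewrite /call_nrank -(nth_map _ (init M)) ?size_context_nonterms // map_nonterm_state.
rewrite (nth_map (Var 0)) ?size_rule_forest //.
set q := nth _ _ _; have /= := rhs_pattern q rk.
have -> : rhs q (rule_symbol r) =
    relabel (nth q0 (rule_calls r)) (nth (Var 0) (rule_forest r) i).
  by rewrite -(nth_map _ (Var 0)) ?size_rule_forest // rule_forestE (nth_map (init M)).
rewrite pattern_relabelE; apply: pattern_relabel; last exact: rank_call_terminals.
move=> g gt k /=; have glt : g < size (rule_calls r).
  have : g \in left_labels (rule_forest r) by apply: mem_left_labels gt; rewrite size_rule_forest.
  by rewrite left_labels_rule_forest mem_iota.
rewrite /call_rank; case: ifP => // _ [<-]; congr (Some (srank _)).
exact: rule_nonterm_state.
Qed.

Lemma left_labels_call_rhs r :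
  left_labels (call_rhs r) = [seq rule_nonterm r g | g <- iota 0 (size (rule_calls r))].
Proof. by rewrite /call_rhs left_labels_relabel left_labels_rule_forest. Qed.

Lemma call_rhs_uniq r : uniq (left_labels (call_rhs r)).
Proof.
rewrite left_labels_call_rhs map_inj_in_uniq ?iota_uniq // => g g'.
rewrite !mem_iota /= => glt glt' [] _ /(congr1 val) /=.
by rewrite (inord_call glt) (inord_call glt').
Qed.

Lemma mem_live_children r i : (i \in live_children r) =
  (context_states (rule_child r i) != [::]) && (i < size (rule_states r)).
Proof. by rewrite mem_filter mem_iota. Qed.

Lemma call_links_bignt r : {subset call_links r <= call_bignt}.
Proof.
move=> _ /mapP[i + ->]; rewrite mem_live_children => /andP[ne _].
by apply/call_bigntP; exists (rule_child r i).
Qed.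

Lemma call_links_disjoint r : uniq (flatten (call_links r)).
Proof.
apply: uniq_flatten_map; first by rewrite filter_uniq ?iota_uniq.
  by move=> i _; apply: uniq_context_nonterms.
move=> i j; rewrite !mem_live_children => /andP[_ il] /andP[_ jl] n.
move=> /nonterm_contextK ni /nonterm_contextK; rewrite ni => -[_ /(congr1 val) /=].
by rewrite (inord_child il) (inord_child jl).
Qed.

Lemma mem_call_link r g : g < size (rule_calls r) ->
  let i := (nth q0 (rule_calls r) g).2 in
  i \in live_children r /\ rule_nonterm r g \in context_nonterms (rule_child r i).
Proof.
move=> glt i; have il : i < size (rule_states r) := rule_call_child glt.
have gi : rule_nonterm r g \in context_nonterms (rule_child r i).
  by rewrite rule_child_nonterms // map_f // mem_filter eqxx mem_iota.
split=> //; rewrite mem_live_children il andbT -map_nonterm_state.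
by case: context_nonterms gi.
Qed.

Lemma call_links_cover r : flatten (call_links r) =i left_labels (call_rhs r).
Proof.
move=> n; rewrite left_labels_call_rhs; apply/flatten_mapP/mapP => [[i]|[g]].
  rewrite mem_live_children => /andP[_ il]; rewrite rule_child_nonterms //.
  by case/mapP=> g; rewrite mem_filter => /andP[_ gl] ->; exists g.
rewrite mem_iota => /= glt ->.
by have [h1 h2] := mem_call_link glt; exists (nth q0 (rule_calls r) g).2.
Qed.

Definition call_grammar : mcftg :=
  @Mcftg call_nonterm call_nrank call_bignt call_terminals None call_rule
    (fun r => context_nonterms (rule_context r)) call_rhs call_links
    call_bignt_nonempty call_bignt_uniq call_bignt_occ call_terminals_rank
    call_start_bignt (init_rank M) call_lhs_bignt call_rhs_pattern call_rhs_uniq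
    call_links_bignt call_links_disjoint call_links_cover.

(** * Derivations of the grammar and evaluation on accepted trees *)

Lemma eval_call_rule r ss (f : seq call_nonterm -> seq (term symbol)) :
  size ss = size (rule_states r) ->
  {in live_children r, forall i, f (context_nonterms (rule_child r i)) =
    map (@eval M (nth (Var 0) ss i) \o nonterm_state) (context_nonterms (rule_child r i))} ->
  map (link_subst (call_links r) f) (call_rhs r) =
  map (@eval M (Op (val (rule_symbol r)) ss) \o nonterm_state)
      (context_nonterms (rule_context r)).
Proof.
move=> sz fE; rewrite map_comp map_nonterm_state /=.
rewrite (map_comp (subst _) (fun q => rhs q (val (rule_symbol r)))) -rule_forestE -!map_comp.
apply: eq_map_left_labels => t tsub /=.
have glt g : g \in left_labels [:: t] -> g < size (rule_calls r).
  by move=> /tsub; rewrite left_labels_rule_forest mem_iota.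
(* A nonterminal records which subtree it calls, so the single function [h] serves all links. *)
pose h n := @eval M (nth (Var 0) ss (nonterm_child n)) (nonterm_state n).
transitivity (subst h (relabel (rule_nonterm r) t)).
  apply: (@eq_in_link_subst _ _ _ _ (fun _ => h) _ _ (call_links_disjoint r)).
  - move=> _ /mapP[i il ->]; rewrite fE //; move: il; rewrite mem_live_children => /andP[_ il].
    rewrite rule_child_nonterms //; apply/eq_in_map => _ /mapP[g + ->].
    rewrite mem_filter mem_iota => /andP[/eqP gi /= gl].
    by rewrite /h rule_nonterm_child // gi.
  - move=> n; rewrite (left_labels_relabel _ [:: t]) => /mapP[g /glt gl ->].
    have [h1 h2] := mem_call_link gl.
    by eexists; split; [apply: (map_f _ h1)|exact: h2|].
rewrite !subst_relabel; apply: eq_in_subst => g /glt gl.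
transitivity (h (rule_nonterm r g)) => //.
rewrite /h rule_nonterm_child // rule_nonterm_state //=.
by rewrite (nth_map (Var 0)) // sz rule_call_child.
Qed.

(** The input tree is rebuilt from the derivation: called subtrees come from the induction
    hypothesis, the others from the reachability demanded of the rule. *)
Lemma generates_call B fs : @generates call_grammar B fs ->
  exists c, B = context_nonterms c /\ exists s p,
    [/\ accepted s p, context_ok c p & fs = map (@eval M s \o nonterm_state) B].
Proof.
elim=> {B fs} r f _ IH; exists (rule_context r); split=> //.
have [_ _ rkA rkM [[p cp tp] prod]] := call_ruleP r.
have p0 := p.
have [|ss [szs ssP]] := @seq_choice _ (term symbol) (fun i s =>
    accepted s (nth p0 (rule_states r) i) /\ (i \in live_children r ->
    f (context_nonterms (rule_child r i)) =
    map (@eval M s \o nonterm_state) (context_nonterms (rule_child r i))))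
  (iota 0 (size (rule_states r))).
  move=> i; rewrite mem_iota /= add0n => il.
  case li: (i \in live_children r); last first.
    by have [s sp] := prod _ (mem_nth p0 il); exists s.
  have [c [cE [s [q [sq cq fE]]]]] := IH _ (map_f _ li).
  exists s; split=> //.
  move: li; rewrite mem_live_children => /andP[ne _].
  (* The big nonterminal determines its context, so the state [q] from the induction hypothesis is
     the one that the rule prescribes for child [i]. *)
  move: cq; rewrite -(@context_nonterms_inj (rule_child r i) c) //; last by rewrite cE.
  by move=> /= /eqP/(onth_nth p0) ->.
rewrite size_iota in szs ssP.
have {}ssP i : i < size (rule_states r) -> accepted (nth (Var 0) ss i) (nth p0 (rule_states r) i)
    /\ (i \in live_children r -> f (context_nonterms (rule_child r i)) =
    map (@eval M (nth (Var 0) ss i) \o nonterm_state) (context_nonterms (rule_child r i))).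
  by move=> il; have := ssP 0 (Var 0) i il; rewrite nth_iota.
exists (Op (val (rule_symbol r)) ss), p; split=> //; last first.
  apply: eval_call_rule => // i li; have := li; rewrite mem_live_children => /andP[_ il].
  exact: (ssP i il).2.
split.
  apply: (@Run A _ _ (rule_states r)); rewrite ?szs // => i il.
  by have [[+ _] _] := ssP i il; rewrite (set_nth_default p).
rewrite /= rkM szs eqxx /=; apply/(all_nthP (Var 0)) => i; rewrite szs => il.
by have [[]] := ssP i il.
Qed.

(** Induction on the run, each transition giving one rule. Membership in [sts] is carried along
    because it bounds the states of every context by [K]. *)
Lemma call_generates s p c :
  (forall qs, @sts M qs -> size qs <= K) -> accepted s p -> context_ok c p ->
  @sts M (context_states c) -> context_states c != [::] ->
  @generates call_grammar (context_nonterms c)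
    (map (@eval M s \o nonterm_state) (context_nonterms c)).
Proof.
move=> leK [rs]; elim: rs c => {s p} w ss ps p rkA szp rss IH tp c /= /andP[/eqP rkM ranks].
move=> cp stsc ne.
have wlt : w < symbol_bound by exact: alphabet_boundP rkM.
have szps : size ps <= arity_bound.
  by have := leq_bigmax (Ordinal wlt) (F := fun w : W => odflt 0 (rank_in (input M) w));
     rewrite /= rkM szp.
have acc i : i < size ss -> accepted (nth (Var 0) ss i) (nth p ps i).
  by move=> il; split; [exact: rss|exact: (all_nthP _ ranks)].
have v : call_rule_valid (c, Ordinal wlt, Bseq szps).
  rewrite /call_rule_valid /= leK // rkA rkM szp eqxx /= andbT lt0n size_eq0 ne /=.
  apply/andP; split; first by apply/existsP; exists p; rewrite cp.
  apply/(all_nthP p) => i; rewrite szp => il; apply/asboolP.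
  by exists (nth (Var 0) ss i); exact: acc.
pose r : call_rule := exist (fun x => is_true (call_rule_valid x)) _ v.
pose f (B : seq call_nonterm) :=
  map (fun n => @eval M (nth (Var 0) ss (nonterm_child n)) (nonterm_state n)) B.
have fE : {in live_children r, forall i, f (context_nonterms (rule_child r i)) =
    map (@eval M (nth (Var 0) ss i) \o nonterm_state) (context_nonterms (rule_child r i))}.
  move=> i; rewrite mem_live_children => /andP[_ il].
  rewrite rule_child_nonterms //; apply/eq_in_map => _ /mapP[g + ->].
  by rewrite mem_filter mem_iota => /andP[/eqP gi gl]; rewrite rule_nonterm_child ?gi.
have := @Generates call_grammar r f; rewrite [map _ _](@eval_call_rule r ss) //; apply.
move=> _ /mapP[i li ->]; rewrite fE //.
move: li; rewrite mem_live_children => /andP[nei il].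
have il' : i < size ss by rewrite -szp.
apply: IH => //.
- exact: (acc i il').2.
- by rewrite /= onthE (nth_map p).
- rewrite rule_child_states //; apply: StsStep rkM il' stsc.
Qed.

Lemma mcftg_language_call :
  (forall qs, @sts M qs -> size qs <= K) ->
  mcftg_language call_grammar =
  [set t | exists2 s, nfta_language A s & realized M (s, t)]%classic.
Proof.
move=> leK; apply/seteqP; split=> t.
  move=> /generates_call[c [cE [s [p [[rs ks] cp [->]]]]]].
  (* The initial nonterminal belongs to the initial context alone, so the state at the root is
     final. *)
  have c0 : c = None by rewrite -(@nonterm_contextK c None) // -cE mem_head.
  exists s; first by exists p => //; move: cp; rewrite c0.
  split=> //; have /andP[_ vs] := run_trees rs.
  by apply/andP.
case=> s [p fp rs] [/andP[ks _] /= ->].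
apply: (@call_generates s p None) => //; exact: StsInit.
Qed.

End TransducerToGrammar.

(** * The inclusions of images, and the two equalities *)

Lemma finite_copying_bound M : finite_copying M -> exists K, forall qs, @sts M qs -> size qs <= K.
Proof.
case/finite_seqP => l lE; exists (\max_(qs <- l) size qs) => qs; rewrite lE /= => ql.
exact: (@leq_bigmax_seq _ _ xpredT size).
Qed.

Lemma images_sub_MCFT : (images DMTfc RT `<=` MCFT)%classic.
Proof.
move=> L [_ [_ [[M [/finite_copying_bound[K leK] <-]] [A <-] _ ->]]].
exists (call_grammar M A K); exact: mcftg_language_call.
Qed.

(** Nonterminals have the ranks of their states, which are all 0 for a top-down transducer. *)
Lemma images_sub_MRT : (images DTfc RT `<=` MRT)%classic.
Proof.
move=> L [_ [_ [[M [dtM /finite_copying_bound[K leK] <-]] [A <-] _ ->]]].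
exists (call_grammar M A K); split; last exact: mcftg_language_call.
by move=> n; exact: dtM.
Qed.

Theorem theorem76 : MCFT = images DMTfc RT /\ MRT = images DTfc RT.
Proof.
split; apply/seteqP; split.
- exact: MCFT_sub_images.
- exact: images_sub_MCFT.
- exact: MRT_sub_images.
- exact: images_sub_MRT.
Qed.
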